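(* Let $m\geq 3$ be an odd integer and let $c$ be an integer with $\gcd(c,m)=1$. Then for every residue $r\in\{0,1,\dots,m-1\}$ there is an integer $n_r\geq 0$ such that $2^{n_r}+cn_r\equiv r\pmod m$. Equivalently, the sequence $\{2^n+cn\bmod m\}_{n\geq 0}$ visits all $m$ residue classes modulo $m$. *)

(* Defs.v *)
From mathcomp Require Import all_boot all_order all_algebra.

Set Implicit Arguments.
Unset Strict Implicit.
Unset Printing Implicit Defensive.

Import GRing.Theory.
Local Open Scope ring_scope.

Definition pow2lin (c : int) (n : nat) : int := 2 ^+ n + c * n%:Z.

(* Main.v *)
Require Import Defs.
From mathcomp Require Import all_boot all_order all_algebra.
From mathcomp Require Import cyclic.
From mathcomp Require Import ring.

Set Implicit Arguments.
Unset Strict Implicit.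
Unset Printing Implicit Defensive.

Import GRing.Theory.
Local Open Scope ring_scope.

(** Strong induction on the modulus.  With [T = totient m] and [d = gcd(T, m)],
    which is smaller than [m], the residue [r] is attained modulo [d] at some
    [n0].  Replacing [n0] by [n0 + T * k] does not change the power modulo [m]
    (Euler) and adds [c * T * k]; as [c] is a unit, these are all the multiples
    of [d] modulo [m], so a suitable [k] removes the remaining error. *)

Lemma totient_ltn (m : nat) : (1 < m)%N -> (totient m < m)%N.
Proof.
case: m => [//|m] m_gt1; rewrite totient_count_coprime big_mkord big_ord_recl /=.
(* The term split off is that of [0], which is not coprime to a modulus above 1; each remaining term
   is at most 1. *)
rewrite /coprime gcdn0 gtn_eqF // add0n ltnS.
by rewrite -[leqRHS]card_ord -sum1_card; apply: leq_sum => i _; exact: leq_b1.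
Qed.

Lemma dvdz_linear_solution (a s : int) (m : nat) :
  (0 < m)%N -> (gcdz a m %| s)%Z -> exists k : nat, (m%:Z %| a * k%:Z - s)%Z.
Proof.
move=> m_gt0 /dvdzP[q ->]; have [u [v <-]] := Bezoutz a m%:Z.
have m_neq0 : m%:Z != 0 by rewrite eqz_nat -lt0n.
(* Scaling the Bezout identity by [q] gives the integer solution [q * u]; reducing it modulo [m]
   makes it a natural number. *)
exists `|((q * u) %% m)%Z|%N; rewrite gez0_abs ?modz_ge0 //.
apply/dvdzP; exists (- (a * ((q * u) %/ m)%Z + q * v)).
have -> : ((q * u) %% m)%Z = q * u - ((q * u) %/ m)%Z * m by [].
ring.
Qed.

(** Both coprimality hypotheses pass to divisors of [m], so the induction can descend to [d],
    possibly down to modulus 1. *)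
Lemma exp_plus_linear_surj (b m : nat) (c r : int) :
    (0 < m)%N -> coprime b m -> coprimez c m ->
  exists n : nat, (m%:Z %| b%:Z ^+ n + c * n%:Z - r)%Z.
Proof.
elim/ltn_ind: m => m IHm m_gt0 co_bm co_cm.
have [m_le1|m_gt1] := leqP m 1.
  have -> : m = 1%N by apply/eqP; rewrite eqn_leq m_le1.
  by exists 0; rewrite dvd1z.
pose T := totient m; pose d := gcdn T m.
have T_gt0 : (0 < T)%N by rewrite totient_gt0.
have d_dvd_m : (d %| m)%N by apply: dvdn_gcdr.
have d_gt0 : (0 < d)%N by rewrite gcdn_gt0 T_gt0.
have d_lt_m : (d < m)%N.
  by apply: leq_ltn_trans (totient_ltn m_gt1); rewrite dvdn_leq ?dvdn_gcdl.
have co_cd : coprimez c d by apply: coprimez_dvdr co_cm.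
have [n0 n0P] := IHm d d_lt_m d_gt0 (coprime_dvdr d_dvd_m co_bm) co_cd.
have gcd_cT : gcdz (c * T%:Z) m = d%:Z.
  by rewrite gcdzC Gauss_gcdzr 1?coprimez_sym // gcdzC.
have [|k kP] :=
    @dvdz_linear_solution (c * T%:Z) (r - (b%:Z ^+ n0 + c * n0%:Z)) m m_gt0.
  by rewrite gcd_cT -opprB rpredN.
exists (n0 + T * k)%N.
have b_pow : (m%:Z %| b%:Z ^+ (T * k) - 1)%Z.
  rewrite -eqz_mod_dvd -rmorphXn /= natrXE.
  by rewrite !modz_nat eqz_nat expnM -modnXm Euler_exp_totient // modnXm exp1n.
(* The first summand vanishes modulo [m] by [b_pow], the second by [kP]. *)
have -> : b%:Z ^+ (n0 + T * k) + c * (n0 + T * k)%N%:Z - r =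
    b%:Z ^+ n0 * (b%:Z ^+ (T * k) - 1)
    + (c * T%:Z * k%:Z - (r - (b%:Z ^+ n0 + c * n0%:Z))).
  rewrite exprD PoszD PoszM; ring.
by rewrite rpredD // dvdz_mull.
Qed.

Theorem mainTheorem3 (m : nat) (c : int) (hm : (3 <= m)%N) (hodd : odd m)
    (hc : gcdz c m%:Z = 1) :
  (forall r : nat, (r < m)%N ->
     exists n : nat, (pow2lin c n = r%:Z %[mod m%:Z])%Z) /\
  (forall x : 'Z_m, exists n : nat, (pow2lin c n)%:~R = x).
Proof.
have surj (r : nat) : exists n : nat, (m%:Z %| pow2lin c n - r%:Z)%Z.
  apply: (@exp_plus_linear_surj 2 m c r); first exact: leq_trans hm.
    by rewrite coprime2n.
  exact/eqP.
split=> [r _|x].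
  by have [n nP] := surj r; exists n; apply/eqP; rewrite eqz_mod_dvd.
(* Here [x] is coerced to its natural representative, which [natr_Zp] later casts back to [x]. *)
have [n /dvdzP[q nP]] := surj x; exists n.
have m_gt1 : (1 < m)%N by apply: leq_trans hm.
have /eqP := congr1 (fun z : int => z%:~R : 'Z_m) nP.
by rewrite intrM intrB -!pmulrn pchar_Zp // mulr0 subr_eq0 natr_Zp => /eqP.
Qed.
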